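(* Let $\Omega \subset \mathbb{C}^d$, $d \ge 1$, be a bounded domain. Let $U$ and $W$ be open subsets of $\mathbb{C}^d$ with $W \subset\subset U$, $W \cap \Omega \neq \emptyset$ and $U \cap \Omega$ connected, and suppose there exists a constant $C_0 > 0$ such that for all $z, w \in W \cap \Omega$, $$\mathsf{k}_{U \cap \Omega}(z, w) \le \mathsf{k}_{\Omega}(z, w) + C_0.$$ Then there exists a constant $C \ge 1$ such that for all $z, w \in W \cap \Omega$, $$\mathsf{k}_{U \cap \Omega}(z, w) \le C\, \mathsf{k}_{\Omega}(z, w).$$
   Context: For a domain $D \subset \mathbb{C}^d$, $\mathsf{k}_D$ is the Kobayashi pseudodistance. $W \subset\subset U$ means that $\overline{W}$ is compact and $\overline{W} \subset U$. *)

(* Defs.v *)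
From HB Require Import structures.
From mathcomp Require Export all_boot all_order all_algebra.
From mathcomp Require Export complex.
From mathcomp Require Export all_classical all_reals all_analysis.
Export Order.TTheory GRing.Theory Num.Theory.
Export numFieldNormedType.Exports.

Set Implicit Arguments.
Unset Strict Implicit.
Unset Printing Implicit Defensive.

Local Open Scope classical_set_scope.
Local Open Scope ring_scope.

(* The library equips an abstract numFieldType with its norm topology, but not
   the concrete type R[i]; these are the same structures, copied from R[i]^o. *)
HB.instance Definition _ (R : realType) := GRing.ComAlgebra.copy R[i] R[i]^o.
HB.instance Definition _ (R : realType) := Vector.copy R[i] R[i]^o.
HB.instance Definition _ (R : realType) := NormedModule.copy R[i] R[i]^o.

(* C^d is 'rV[R[i]]_d. The library's norm on it is the sup norm, which induces
   the same topology and the same bounded sets as the Euclidean norm. *)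

Definition unit_disc (R : realType) : set R[i] := [set z | `|z| < 1].

(* [derivable f z 1] over the field R[i] is the existence of the limit of
   h^-1 *: (f (h + z) - f z) as the complex number h tends to 0. Since the disc
   is open, the values of [f] outside the disc are irrelevant. *)
Definition holomorphic_disc (R : realType) (d : nat) (D : set 'rV[R[i]]_d)
    (f : R[i] -> 'rV[R[i]]_d) : Prop :=
  forall z, unit_disc z -> derivable f z 1 /\ D (f z).

(* artanh |(a - b) / (1 - conj(a) b)|, i.e. curvature -4. The norm of a complex
   number is an element of R[i], whence the real part. *)
Definition poincare_dist (R : realType) (a b : R[i]) : R :=
  let t := complex.Re `|(a - b) / (1 - a^* * b)| in
  ln ((1 + t) / (1 - t)) / 2.

Definition chain_length (R : realType) (d : nat) (D : set 'rV[R[i]]_d)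
    (z w : 'rV[R[i]]_d) (L : R) : Prop :=
  exists (n : nat) (p : nat -> 'rV[R[i]]_d)
         (f : nat -> R[i] -> 'rV[R[i]]_d) (a b : nat -> R[i]),
    [/\ (0 < n)%N, p 0%N = z, p n = w,
        (forall j, (j < n)%N ->
           [/\ holomorphic_disc D (f j), unit_disc (a j), unit_disc (b j),
               f j (a j) = p j & f j (b j) = p j.+1])
      & L = \sum_(j < n) poincare_dist (a j) (b j)].

(* Extended-real valued: it is +oo exactly when no chain joins [z] to [w],
   which does not happen for two points of a domain. *)
Definition kobayashi (R : realType) (d : nat) (D : set 'rV[R[i]]_d)
    (z w : 'rV[R[i]]_d) : \bar R :=
  ereal_inf [set L%:E | L in [set L | chain_length D z w L]].

Definition domain (R : realType) (d : nat) (D : set 'rV[R[i]]_d) : Prop :=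
  [/\ open D, connected D & D !=set0].

Definition compactly_contained (T : topologicalType) (W U : set T) : Prop :=
  compact (closure W) /\ closure W `<=` U.

(* Main.v *)
Require Import Defs.
From mathcomp Require Import ring lra.

(** When [kobayashi Omega z w] is at least a fixed [e0 > 0], the additive error
    [C0] is at most [C0 / e0] times the distance, so the hypothesis is already a
    multiplicative estimate. The content is the case of points at small
    distance, where the comparison follows from the localization of holomorphic
    discs; it rests on [Omega] being bounded and [W] staying away from the
    complement of [U].

    Take a chain of discs in [Omega] of length [L < e0] that starts in [W]. A
    holomorphic map [f] from the unit disc into a bounded set satisfies a
    Lipschitz estimate: moving from [a] by [(1 - |a|) * zeta] with
    [|zeta| <= 1/2] changes [f] by at most a constant times [|zeta|]
    ([disc_lipschitz]). This has two consequences. The nodes of the chain drift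
    by at most a constant times [L], so they stay well inside [U]. And each disc
    [f], restricted to the round disc of centre [a] and radius [r * (1 - |a|)]
    for a fixed small [r], stays in [U]. Reparametrizing this smaller disc by
    the unit disc gives a disc in the intersection of [U] and [Omega] through
    the same two nodes, and it multiplies the Poincare length by at most
    [16 / r] ([shrink_disc], [chain_localization]). An affine reparametrization
    suffices because, at small Poincare distance [l], the Euclidean distance
    [|b - a|] is at most [8 * l * (1 - |a|)].

    The Lipschitz estimate comes from Cauchy's bound on the derivative
    ([cauchy_derivative_bound]), which has to be proved for functions that are
    merely complex differentiable at each point. For [f] on a disc around [0],
    the function [G w = (f (exp w) - f 0) / exp w] is holomorphic on a half
    plane and [2 * pi * i]-periodic, so its integral over a vertical segment of
    length [2 * pi] does not depend on the abscissa. On the far left [G] tends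
    to [f' 0], and on the line that [exp] maps to the circle of radius [r] it is
    at most [2 * M / r]. That the integral is constant is Goursat's theorem,
    stated for a real one-form [P dx + Q dy] which is closed pointwise
    ([loop_int_eq0]) and proved by bisection of rectangles. *)

Set Implicit Arguments.
Unset Strict Implicit.
Unset Printing Implicit Defensive.

Local Open Scope classical_set_scope.
Local Open Scope ring_scope.

(** * Integrals of continuous functions over segments *)

Section segment_integral.
Variable R : realType.
Implicit Types (f g : R -> R) (a b c e : R).

Definition seg_int f a b : R := \int[@lebesgue_measure R]_(x in `[a, b]) f x.

(** Two-sided continuity also at the end points: the functions integrated here
    are restrictions of functions that are regular in a neighbourhood. *)
Definition cont_on f a b := {in `[a, b], forall x, {for x, continuous f}}.

Lemma seg_integrable f a b : cont_on f a b ->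
  (@lebesgue_measure R).-integrable `[a, b] (EFin \o f).
Proof.
move=> cf; apply: continuous_compact_integrable; first exact: segment_compact.
by apply: continuous_in_subspaceT => x /set_mem; exact: cf.
Qed.

Lemma seg_int_split f a c b : a <= c -> c <= b -> cont_on f a b ->
  seg_int f a b = seg_int f a c + seg_int f c b.
Proof.
move=> ac cb cf; have fi := seg_integrable cf.
apply/eqP; rewrite addrC -subr_eq; apply/eqP.
rewrite /seg_int -(Rintegral_itv_obnd_cbnd (r := c)); last first.
  apply: integrableS fi => //.
  by move=> x /=; rewrite !in_itv/= => /andP[cx ->]; rewrite (le_trans ac (ltW cx)).
exact: Rintegral_itvB.
Qed.

Lemma seg_int_cst c a b : a <= b -> seg_int (fun=> c) a b = c * (b - a).
Proof.
move=> ab; rewrite /seg_int Rintegral_cst//= lebesgue_measure_itv/= lte_fin.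
move: ab; rewrite le_eqVlt => /predU1P[->|->//].
by rewrite ltxx subrr.
Qed.

(** With additivity, the only property of the integral on which Goursat's
    argument relies: an integrand close to a constant has an integral close to
    that constant times the length. *)
Lemma seg_int_near f a b c e : a <= b -> cont_on f a b ->
  (forall x, x \in `[a, b] -> `|f x - c| <= e) ->
  `|seg_int f a b - c * (b - a)| <= e * (b - a).
Proof.
move=> ab cf fc.
have cc k : cont_on (fun=> k) a b by move=> x _; exact: cst_continuous.
have fE x : x \in `[a, b] -> c - e <= f x <= c + e.
  by move=> /fc; rewrite ler_distl.
have lo : seg_int (fun=> c - e) a b <= seg_int f a b.
  apply: le_Rintegral => //; try exact: seg_integrable.
  by move=> x /fE/andP[].
have hi : seg_int f a b <= seg_int (fun=> c + e) a b.
  apply: le_Rintegral => //; try exact: seg_integrable.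
  by move=> x /fE/andP[].
move: lo hi; rewrite !seg_int_cst// !mulrDl mulNr ler_distl => -> ->//.
Qed.

Lemma seg_intB f g a b : cont_on f a b -> cont_on g a b ->
  seg_int (fun x => f x - g x) a b = seg_int f a b - seg_int g a b.
Proof. by move=> cf cg; rewrite /seg_int RintegralB//; exact: seg_integrable. Qed.

Lemma seg_intB_near f g a b c e : a <= b -> cont_on f a b -> cont_on g a b ->
  (forall x, x \in `[a, b] -> `|f x - g x - c| <= e) ->
  `|seg_int f a b - seg_int g a b - c * (b - a)| <= e * (b - a).
Proof.
move=> ab cf cg fgc; rewrite -seg_intB//; apply: seg_int_near => // x xab.
by apply: continuousB; [exact: cf|exact: cg].
Qed.

End segment_integral.

(** * Nested rectangles *)

Section nested_bisection.
Variable R : realType.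

Lemma bisection_limit (a : R) (x : nat -> R) (c : nat -> bool) : 0 <= a ->
  (forall n, x n.+1 = x n + (c n)%:R * (a / 2 ^+ n.+1)) ->
  exists z, forall n, x n <= z <= x n + a / 2 ^+ n.
Proof.
move=> a0 xS.
have h n : a / 2 ^+ n = a / 2 ^+ n.+1 + a / 2 ^+ n.+1.
  by rewrite exprS; field; rewrite expf_neq0.
have h0 n : 0 <= a / 2 ^+ n by rewrite divr_ge0// exprn_ge0.
have xle m k : x m <= x (m + k)%N.
  elim: k => [|k IH]; first by rewrite addn0.
  by rewrite addnS xS (le_trans IH)// lerDl mulr_ge0// ler0n.
have xge m k : x (m + k)%N + a / 2 ^+ (m + k) <= x m + a / 2 ^+ m.
  elim: k => [|k IH]; first by rewrite addn0.
  rewrite addnS xS (le_trans _ IH)// (h (m + k)%N) -addrA lerD2l lerD2r.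
  by case: (c _); rewrite ?mul1r ?mul0r.
have xub n m : x m <= x n + a / 2 ^+ n.
  have [mn|/ltnW nm] := leqP m n.
    by rewrite -(subnKC mn) (le_trans (xle m (n - m)%N))// lerDl.
  rewrite (le_trans _ (xge n (m - n)%N))// subnKC// lerDl//.
exists (sup (range x)) => n; apply/andP; split.
  apply: ub_le_sup; last by exists n.
  by exists (x 0%N + a / 2 ^+ 0) => _ [m _ <-].
apply: ge_sup; first by exists (x 0%N); exists 0%N.
by move=> _ [m _ <-].
Qed.

(** The data [(x, y)] is the lower left corner of a rectangle of sides
    [a / 2 ^+ n] and [b / 2 ^+ n]; a property of rectangles that always passes to
    one of the four quarters holds for arbitrarily small rectangles around a
    common point. *)
Lemma nested_bisection (a b : R) (P : nat -> R -> R -> Prop) (x0 y0 : R) :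
  0 <= a -> 0 <= b -> P 0%N x0 y0 ->
  (forall n x y, P n x y -> exists c d : bool,
     P n.+1 (x + c%:R * (a / 2 ^+ n.+1)) (y + d%:R * (b / 2 ^+ n.+1))) ->
  exists zx zy, forall n, exists x y,
    [/\ P n x y, x <= zx <= x + a / 2 ^+ n & y <= zy <= y + b / 2 ^+ n].
Proof.
move=> a0 b0 P0 PS.
pose T := (nat * (R * R))%type.
have next (u : {u : T | P u.1 u.2.1 u.2.2}) :
  {v : {v : T | P v.1 v.2.1 v.2.2} | exists c d : bool,
    sval v = ((sval u).1.+1, ((sval u).2.1 + c%:R * (a / 2 ^+ (sval u).1.+1),
      (sval u).2.2 + d%:R * (b / 2 ^+ (sval u).1.+1)))}.
  apply: cid; case: u => -[n [x y]] /= /PS[c [d Pcd]].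
  by exists (exist _ (n.+1, (_, _)) Pcd); exists c, d.
have [F [F0 FS]] := dependent_choice next (exist _ (0%N, (x0, y0)) P0).
have Fn n : (sval (F n)).1 = n.
  elim: n => [|n IH]; first by rewrite F0.
  by have [c [d ->]] := FS n; rewrite /= IH.
have /choice[c cP] n : exists c : bool,
    (sval (F n.+1)).2.1 = (sval (F n)).2.1 + c%:R * (a / 2 ^+ n.+1).
  by have [c [d ->]] := FS n; exists c; rewrite /= Fn.
have /choice[d dP] n : exists d : bool,
    (sval (F n.+1)).2.2 = (sval (F n)).2.2 + d%:R * (b / 2 ^+ n.+1).
  by have [c' [d ->]] := FS n; exists d; rewrite /= Fn.
have [zx zxP] := bisection_limit a0 cP.
have [zy zyP] := bisection_limit b0 dP.
exists zx, zy => n; exists (sval (F n)).2.1, (sval (F n)).2.2; split => //.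
by have := svalP (F n); rewrite Fn.
Qed.

End nested_bisection.

(** * Goursat's theorem for a pointwise closed form *)

Section green_goursat.
Variable R : realType.
Implicit Types (P Q : R -> R -> R) (x y e : R).

(** Differentiability of [P] and [Q] at [(x, y)] with [dP/dy = dQ/dx], both
    equal to [c]. These derivatives may be discontinuous in [(x, y)], so Green's
    formula is not at hand and Goursat's bisection takes its place. *)
Definition closed_form_at P Q x y := exists p1 c q2, forall e, 0 < e ->
  exists2 dl : R, 0 < dl & forall h k : R, `|h| < dl -> `|k| < dl ->
    `|P (x + h) (y + k) - P x y - (p1 * h + c * k)| <= e * (`|h| + `|k|) /\
    `|Q (x + h) (y + k) - Q x y - (c * h + q2 * k)| <= e * (`|h| + `|k|).

Definition closed_form_on P Q x1 x2 y1 y2 :=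
  forall x y, x \in `[x1, x2] -> y \in `[y1, y2] -> closed_form_at P Q x y.

Lemma affine_approx_continuous (f : R -> R) x m :
  (exists2 dl : R, 0 < dl & forall h, `|h| < dl -> `|f (x + h) - f x - m * h| <= `|h|) ->
  {for x, continuous f}.
Proof.
case=> dl dl0 H; apply/cvgrPdist_le => /= e e0.
have m0 : 0 < `|m| + 1 by rewrite ltr_pwDr.
near=> t.
have th : `|t - x| < Num.min dl (e / (`|m| + 1)).
  rewrite distrC; near: t; apply/nbhs_ballP.
  exists (Num.min dl (e / (`|m| + 1))) => //=.
  by rewrite lt_min dl0 divr_gt0.
move: th; rewrite lt_min => /andP[/H]; rewrite [x + _]addrC subrK => H1.
rewrite ltr_pdivlMr// => H2.
have -> : f x - f t = - ((f t - f x - m * (t - x)) + m * (t - x)) by ring.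
rewrite normrN (le_trans (ler_normD _ _))// normrM.
apply: le_trans _ (ltW H2); rewrite [leRHS]mulrDr mulr1 [`|m| * _]mulrC.
by rewrite [leLHS]addrC lerD2l; exact: H1.
Unshelve. all: by end_near. Qed.

Lemma closed_form_cont_x P Q x1 x2 y1 y2 y : closed_form_on P Q x1 x2 y1 y2 ->
  y \in `[y1, y2] -> cont_on (P ^~ y) x1 x2.
Proof.
move=> PQ yI x xI; have [p1 [c [q2 H]]] := PQ x y xI yI.
have [dl dl0 {}H] := H 1 ltr01; apply: (@affine_approx_continuous _ _ p1).
exists dl => // h hd; have [+ _] := H h 0 hd (eq_ind_r (fun z => z < dl) dl0 (normr0 R)).
by rewrite normr0 mulr0 !addr0 mul1r.
Qed.

Lemma closed_form_cont_y P Q x1 x2 y1 y2 x : closed_form_on P Q x1 x2 y1 y2 ->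
  x \in `[x1, x2] -> cont_on (Q x) y1 y2.
Proof.
move=> PQ xI y yI; have [p1 [c [q2 H]]] := PQ x y xI yI.
have [dl dl0 {}H] := H 1 ltr01; apply: (@affine_approx_continuous _ _ q2).
exists dl => // h hd; have [_ +] := H 0 h (eq_ind_r (fun z => z < dl) dl0 (normr0 R)) hd.
by rewrite normr0 mulr0 !add0r addr0 mul1r.
Qed.

(** The integral of [P dx + Q dy] along the boundary of a rectangle,
    counterclockwise. *)
Definition loop_int P Q x1 x2 y1 y2 : R :=
  (seg_int (P ^~ y1) x1 x2 - seg_int (P ^~ y2) x1 x2) +
  (seg_int (Q x2) y1 y2 - seg_int (Q x1) y1 y2).

(** The contributions of the inner edges cancel. *)
Lemma loop_int_quarters P Q x1 x2 xm y1 y2 ym :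
  x1 <= xm -> xm <= x2 -> y1 <= ym -> ym <= y2 ->
  closed_form_on P Q x1 x2 y1 y2 ->
  loop_int P Q x1 x2 y1 y2 =
  loop_int P Q x1 xm y1 ym + loop_int P Q xm x2 y1 ym +
  loop_int P Q x1 xm ym y2 + loop_int P Q xm x2 ym y2.
Proof.
move=> x1m xm2 y1m ym2 PQ.
have x12 := le_trans x1m xm2; have y12 := le_trans y1m ym2.
have cx y : y \in `[y1, y2] -> cont_on (P ^~ y) x1 x2.
  exact: closed_form_cont_x PQ.
have cy x : x \in `[x1, x2] -> cont_on (Q x) y1 y2.
  exact: closed_form_cont_y PQ.
rewrite /loop_int.
rewrite (seg_int_split x1m xm2 (cx y1 _)); last by rewrite in_itv/= lexx.
rewrite (seg_int_split x1m xm2 (cx y2 _)); last by rewrite in_itv/= lexx andbT.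
rewrite (seg_int_split y1m ym2 (cy x1 _)); last by rewrite in_itv/= lexx.
rewrite (seg_int_split y1m ym2 (cy x2 _)); last by rewrite in_itv/= lexx andbT.
ring.
Qed.

(** Near a point of differentiability, [P] and [Q] are affine up to an error
    small with respect to the diameter. For the affine parts the horizontal edges
    contribute [- c] times the area and the vertical ones [c] times the area, so
    only the errors remain, integrated over a boundary of comparable length. *)
Lemma loop_int_small P Q x1 x2 y1 y2 x0 y0 e : 0 < e ->
  x0 \in `[x1, x2] -> y0 \in `[y1, y2] ->
  closed_form_on P Q x1 x2 y1 y2 ->
  exists2 dl : R, 0 < dl & forall u1 u2 v1 v2,
    x1 <= u1 -> u2 <= x2 -> y1 <= v1 -> v2 <= y2 ->
    u1 <= x0 <= u2 -> v1 <= y0 <= v2 -> u2 - u1 < dl -> v2 - v1 < dl ->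
    `|loop_int P Q u1 u2 v1 v2| <= e * ((u2 - u1) + (v2 - v1)) ^+ 2.
Proof.
move=> e0 x0I y0I PQ.
have [p1 [c [q2 H]]] := PQ x0 y0 x0I y0I.
have e20 : 0 < e / 2 by rewrite divr_gt0.
have [dl dl0 {}H] := H _ e20; exists dl => // u1 u2 v1 v2.
move=> xu1 ux2 yv1 vy2 /andP[u1x xu2] /andP[v1y yv2] du dv.
set L := (u2 - u1) + (v2 - v1).
have PQ' : closed_form_on P Q u1 u2 v1 v2.
  move=> x y; rewrite !in_itv/= => /andP[? ?] /andP[? ?].
  by apply: PQ; rewrite in_itv/=; apply/andP; split; lra.
have u12 := le_trans u1x xu2; have v12 := le_trans v1y yv2.
have near x y : x \in `[u1, u2] -> y \in `[v1, v2] ->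
    `|P x y - P x0 y0 - (p1 * (x - x0) + c * (y - y0))| <= e / 2 * L /\
    `|Q x y - Q x0 y0 - (c * (x - x0) + q2 * (y - y0))| <= e / 2 * L.
  rewrite !in_itv/= => /andP[a1 a2] /andP[b1 b2].
  have hx : `|x - x0| <= u2 - u1 by rewrite ler_norml; apply/andP; split; lra.
  have hy : `|y - y0| <= v2 - v1 by rewrite ler_norml; apply/andP; split; lra.
  have [] := H (x - x0) (y - y0) (le_lt_trans hx du) (le_lt_trans hy dv).
  rewrite ![_ + (_ - _)]addrC !subrK => K1 K2.
  have : e / 2 * (`|x - x0| + `|y - y0|) <= e / 2 * L.
    by rewrite ler_pM2l// lerD.
  by move=> K3; split; [exact: le_trans K1 K3|exact: le_trans K2 K3].
have B1 : `|seg_int (P ^~ v1) u1 u2 - seg_int (P ^~ v2) u1 u2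
    - c * (v1 - v2) * (u2 - u1)| <= e * L * (u2 - u1).
  apply: seg_intB_near => //.
  - by apply: closed_form_cont_x PQ' _; rewrite in_itv/= lexx.
  - by apply: closed_form_cont_x PQ' _; rewrite in_itv/= lexx andbT.
  move=> x xI.
  have [|+ _] := near x v1 xI; first by rewrite in_itv/= lexx.
  have [|+ _] := near x v2 xI; first by rewrite in_itv/= lexx andbT.
  rewrite !ler_norml => /andP[? ?] /andP[? ?]; apply/andP; split; lra.
have B2 : `|seg_int (Q u2) v1 v2 - seg_int (Q u1) v1 v2
    - c * (u2 - u1) * (v2 - v1)| <= e * L * (v2 - v1).
  apply: seg_intB_near => //.
  - by apply: closed_form_cont_y PQ' _; rewrite in_itv/= lexx andbT.
  - by apply: closed_form_cont_y PQ' _; rewrite in_itv/= lexx.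
  move=> y yI.
  have [|_ +] := near u1 y _ yI; first by rewrite in_itv/= lexx.
  have [|_ +] := near u2 y _ yI; first by rewrite in_itv/= lexx andbT.
  rewrite !ler_norml => /andP[? ?] /andP[? ?]; apply/andP; split; lra.
rewrite expr2 mulrA {2}/L [leRHS]mulrDr.
apply: le_trans (lerD B1 B2); apply: le_trans (ler_normD _ _).
by rewrite /loop_int le_eqVlt; apply/orP; left; apply/eqP; congr `|_|; ring.
Qed.

(** If the integral were nonzero, one of the quarters would carry at least a
    fourth of it, and so on; around the common point of these rectangles the
    integral would be at least a constant times the square of the diameter,
    against [loop_int_small]. *)
Lemma loop_int_eq0 P Q x1 x2 y1 y2 : x1 <= x2 -> y1 <= y2 ->
  closed_form_on P Q x1 x2 y1 y2 -> loop_int P Q x1 x2 y1 y2 = 0.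
Proof.
move=> x12 y12 PQ; apply/eqP/negPn/negP => I0.
pose a := x2 - x1; pose b := y2 - y1.
have a0 : 0 <= a by rewrite subr_ge0.
have b0 : 0 <= b by rewrite subr_ge0.
pose k := `|loop_int P Q x1 x2 y1 y2|.
have k0 : 0 < k by rewrite normr_gt0.
have h n (u : R) : u / 2 ^+ n = u / 2 ^+ n.+1 + u / 2 ^+ n.+1.
  by rewrite exprS; field; rewrite expf_neq0.
pose bad (n : nat) x y := [/\ x1 <= x, x + a / 2 ^+ n <= x2, y1 <= y, y + b / 2 ^+ n <= y2 &
  k / 4 ^+ n <= `|loop_int P Q x (x + a / 2 ^+ n) y (y + b / 2 ^+ n)|].
have bad0 : bad 0%N x1 y1.
  by split; rewrite // ?expr0 ?divr1 /a /b ?[_ + (_ - _)]addrC ?subrK.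
have badS n x y : bad n x y -> exists c d : bool,
     bad n.+1 (x + c%:R * (a / 2 ^+ n.+1)) (y + d%:R * (b / 2 ^+ n.+1)).
  move=> [A1 A2 A3 A4 A5].
  set a' := a / 2 ^+ n.+1; set b' := b / 2 ^+ n.+1.
  have a'0 : 0 <= a' by rewrite divr_ge0// exprn_ge0.
  have b'0 : 0 <= b' by rewrite divr_ge0// exprn_ge0.
  move: A2 A4 A5; rewrite (h n a) (h n b) -/a' -/b' => A2 A4.
  have PQ' : closed_form_on P Q x (x + (a' + a')) y (y + (b' + b')).
    move=> u v; rewrite !in_itv/= => /andP[? ?] /andP[? ?].
    by apply: PQ; rewrite in_itv/=; apply/andP; split; lra.
  rewrite (@loop_int_quarters _ _ _ _ (x + a') _ _ (y + b')) ?lerD2l ?lerDl ?lerDr//.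
  rewrite [x + (_ + _)]addrA [y + (_ + _)]addrA => A5.
  set k' := k / 4 ^+ n.+1.
  have kE : k / 4 ^+ n = 4 * k' by rewrite /k' exprS; field; rewrite expf_neq0.
  pose J (c d : bool) := loop_int P Q (x + c%:R * a') (x + c%:R * a' + a')
      (y + d%:R * b') (y + d%:R * b' + b').
  have [[c [d Jcd]]|nJ] := pselect (exists c d, k' <= `|J c d|).
    exists c, d; split => //.
    - by rewrite (le_trans A1)// lerDl mulr_ge0.
    - by rewrite -/a'; case: c {Jcd}; rewrite ?mul1r ?mul0r; lra.
    - by rewrite (le_trans A3)// lerDl mulr_ge0.
    - by rewrite -/b'; case: d {Jcd}; rewrite ?mul1r ?mul0r; lra.
  have Jlt c d : `|J c d| < k' by rewrite ltNge; apply/negP => ?; apply: nJ; exists c, d.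
  exfalso; have := Jlt false false; have := Jlt false true.
  have := Jlt true false; have := Jlt true true.
  rewrite /J !mul0r !mul1r !addr0 !ltr_norml.
  move: A5; rewrite kE; set J1 := loop_int _ _ _ _ _ _; set J2 := loop_int _ _ _ _ _ _.
  set J3 := loop_int _ _ _ _ _ _; set J4 := loop_int _ _ _ _ _ _.
  rewrite ler_normr => /orP[]?/andP[? ?] /andP[? ?] /andP[? ?] /andP[? ?]; lra.
have [zx [zy z_bad]] := nested_bisection a0 b0 bad0 badS.
have zxI : zx \in `[x1, x2] /\ zy \in `[y1, y2].
  have [x [y [[A1 A2 A3 A4 _] /andP[? ?] /andP[? ?]]]] := z_bad 0%N.
  by rewrite !in_itv/=; split; apply/andP; split; lra.
case: zxI => zxI zyI.
have ab0 : 0 < (a + b) ^+ 2 + 1 by rewrite ltr_wpDl// sqr_ge0.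
(* [e * (a + b) ^+ 2 < k], so that the scaled estimates contradict each other;
   the [+ 1] covers a rectangle reduced to a point. *)
pose e := k / 2 / ((a + b) ^+ 2 + 1).
have e0 : 0 < e by rewrite !divr_gt0.
have [dl dl0 Hs] := loop_int_small e0 zxI zyI PQ.
have [n nP] : exists n : nat, (a + b) / 2 ^+ n < dl.
  have [n nlt] : exists n : nat, (a + b) / dl < n%:R.
    by exists (Num.trunc ((a + b) / dl)).+1; rewrite truncnS_gt.
  exists n; rewrite ltr_pdivrMr ?exprn_gt0// mulrC -ltr_pdivrMr//.
  apply: lt_trans nlt _; rewrite -natrX ltr_nat; exact: ltn_expl.
have [x [y [[A1 A2 A3 A4 A5] zxx zyy]]] := z_bad n.
have n0 : 0 < (2 ^+ n : R)^-1 by rewrite invr_gt0 exprn_gt0.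
have := Hs x (x + a / 2 ^+ n) y (y + b / 2 ^+ n) A1 A2 A3 A4 zxx zyy.
rewrite ![_ + _ / _ - _]addrAC !subrr !add0r.
have lea : a / 2 ^+ n <= (a + b) / 2 ^+ n by rewrite ler_pM2r// lerDl.
have leb : b / 2 ^+ n <= (a + b) / 2 ^+ n by rewrite ler_pM2r// lerDr.
move=> /(_ (le_lt_trans lea nP) (le_lt_trans leb nP)) /(le_trans A5).
rewrite -mulrDl exprMn exprVn -exprM mulnC exprM.
have -> : (2 : R) ^+ 2 = 4 by ring.
rewrite mulrA ler_pM2r ?invr_gt0 ?exprn_gt0// /e.
rewrite mulrAC ler_pdivlMr//; have := sqr_ge0 (a + b); nra.
Qed.

End green_goursat.

(** * Derivatives as first-order expansions *)

Section first_order_expansion.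
Variable K : numFieldType.

(** Differentiability with explicit constants: it can be applied to several
    points at once and transported between [R[i]] and [R] without limits of
    difference quotients. *)
Definition expands_at (V : normedModType K) (f : K -> V) (z : K) (A : V) :=
  forall e : K, 0 < e -> exists2 dl : K, 0 < dl & forall h : K, `|h| < dl ->
    `|f (z + h) - f z - h *: A| <= e * `|h|.

Lemma is_derive_expandsP (V : normedModType K) (f : K -> V) (z : K) A :
  is_derive z 1 f A <-> expands_at f z A.
Proof.
have P : expands_at f z A <->
    h^-1 *: ((f \o shift z) (h *: 1) - f z) @[h --> 0^'] --> A.
  split=> [fA|/cvgrPdist_le fA e e0].
    apply/cvgrPdist_le => e e0; have [d d0 dP] := fA _ e0.
    apply/(@nbhs_ballP K K); exists d => //.
    move=> h; rewrite -ball_normE /ball_/= sub0r normrN => /dP H h0.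
    rewrite [_ *: 1]mulr1.
    have -> : A - h^-1 *: (f (h + z) - f z) = - (h^-1 *: (f (z + h) - f z - h *: A)).
      by rewrite !scalerBr scalerA mulVf// scale1r !opprB [h + z]addrC.
    by rewrite normrN normrZ normfV ler_pdivrMl ?normr_gt0// mulrC.
  have /(@nbhs_ballP K K)[d /= d0 dP] := fA _ e0.
  exists d => // h hd; have [->|h0] := eqVneq h 0.
    by rewrite addr0 subrr scale0r subr0 !normr0 mulr0.
  have /dP : ball (0 : K) d h by rewrite -ball_normE /ball_/= sub0r normrN.
  move=> /(_ h0); rewrite [_ *: 1]mulr1 => H.
  have -> : f (z + h) - f z - h *: A = - (h *: (A - h^-1 *: (f (h + z) - f z))).
    by rewrite scalerBr scalerA mulfV// scale1r opprB [h + z]addrC.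
  by rewrite normrN normrZ mulrC ler_wpM2r.
rewrite P; split => [[df <-]|fA]; first exact: df.
by apply: DeriveDef; [apply/cvg_ex; exists A|exact: cvg_lim fA].
Qed.

Lemma derivable_expandsP (V : normedModType K) (f : K -> V) (z : K) :
  derivable f z 1 <-> exists A, expands_at f z A.
Proof.
split=> [df|[A /is_derive_expandsP[]//]].
by exists ('D_1 f z); apply/is_derive_expandsP; exact: DeriveDef.
Qed.

End first_order_expansion.

Section generic_derivatives.
Variable K : numFieldType.

Lemma derivable_comp_quotient (f E : K -> K) (c w : K) : E w != 0 ->
  derivable f (E w) 1 -> derivable E w 1 ->
  derivable (fun w => (f (E w) - c) / E w) w 1.
Proof.
move=> E0 df dE; apply: derivableM; last exact: derivableV.
apply: derivableB => //; apply/derivable1_diffP.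
apply: (@differentiable_comp _ _ _ _ E f); exact/derivable1_diffP.
Qed.

Lemma derivable_affine (V : normedModType K) (f : K -> V) (a b z : K) :
  derivable f (a + b * z) 1 -> derivable (fun z => f (a + b * z)) z 1.
Proof.
move=> df; apply/derivable1_diffP.
apply: (@differentiable_comp _ _ _ _ (fun z => a + b * z) f).
  by apply/derivable1_diffP.
exact/derivable1_diffP.
Qed.

Lemma derivable_rV_coord d (f : K -> 'rV[K]_d) i (z : K) :
  derivable f z 1 -> derivable (fun z => f z 0 i) z 1.
Proof.
move=> df; apply/derivable1_diffP.
apply: (@differentiable_comp _ _ _ _ f (fun M : 'rV[K]_d => M 0 i)).
  exact/derivable1_diffP.
exact: differentiable_coord.
Qed.

End generic_derivatives.

Local Open Scope complex_scope.
Local Notation normc := (ComplexField.Normc.normc).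

(** * The real-valued modulus *)

Section complex_modulus.
Variable R : realType.
Implicit Types z w : R[i].

Lemma norm_normc z : `|z| = (normc z)%:C.
Proof. by rewrite normc_def; case: z. Qed.

Lemma normc_ge0 z : 0 <= normc z.
Proof. by case: z => a b; rewrite sqrtr_ge0. Qed.

Lemma normr_Re_le z : `|complex.Re z| <= normc z.
Proof. by case: z => a b /=; rewrite -sqrtr_sqr ler_wsqrtr// lerDl sqr_ge0. Qed.

Lemma normr_Im_le z : `|complex.Im z| <= normc z.
Proof. by case: z => a b /=; rewrite -sqrtr_sqr ler_wsqrtr// lerDr sqr_ge0. Qed.

Lemma normc_le_ReIm z : normc z <= `|complex.Re z| + `|complex.Im z|.
Proof.
case: z => a b /=; rewrite -[leRHS]ger0_norm ?addr_ge0//.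
rewrite -sqrtr_sqr ler_wsqrtr// sqrrD !real_normK ?num_real// lerD2r lerDl.
by rewrite mulrn_wge0// mulr_ge0.
Qed.

Lemma normc_real (x : R) : normc x%:C = `|x|.
Proof. by rewrite /= expr0n/= addr0 sqrtr_sqr. Qed.

Lemma normc_sub z w : normc (z - w) = normc (w - z).
Proof. by rewrite -normcN opprB. Qed.


Lemma normc_triangle z w : normc (z + w) <= normc z + normc w.
Proof. exact: le_normcD. Qed.

Lemma normcM z w : normc (z * w) = normc z * normc w.
Proof. exact: ComplexField.Normc.normcM. Qed.

Lemma normc_eq0 z : (normc z == 0) = (z == 0).
Proof.
apply/eqP/eqP => [/ComplexField.Normc.eq0_normc//|->].
exact: ComplexField.Normc.normc0.
Qed.

Lemma normc_conj z : normc (conjc z) = normc z.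
Proof. by case: z => a b /=; rewrite sqrrN. Qed.

Lemma Re_mul_conj z : complex.Re (conjc z * z) = normc z ^+ 2.
Proof.
case: z => a b /=; rewrite sqr_sqrtr ?addr_ge0 ?sqr_ge0//.
by rewrite mulNr opprK !expr2.
Qed.

(** [expands_at] over [R[i]], with radius, precision and norms in the ordered
    field [R] rather than in [R[i]]. *)
Definition complex_expands_at (f : R[i] -> R[i]) z A := forall e : R, 0 < e ->
  exists2 dl : R, 0 < dl & forall h, normc h < dl ->
    normc (f (z + h) - f z - A * h) <= e * normc h.

Lemma pos_complexE (e : R[i]) : 0 < e -> exists2 k : R, 0 < k & e = k%:C.
Proof.
move=> e0; have eE : e = (complex.Re e)%:C by rewrite RRe_real// gtr0_real.
by exists (complex.Re e) => //; move: e0; rewrite eE ltcR.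
Qed.

Lemma complex_expandsP (f : R[i] -> R[i]) z A :
  complex_expands_at f z A <-> is_derive z (1 : R[i]) f A.
Proof.
split=> [fA|/is_derive_expandsP fA e e0].
  apply/is_derive_expandsP => _ /pos_complexE[e e0 ->].
  have [d d0 dP] := fA _ e0; exists d%:C; first by rewrite ltcR.
  move=> h; rewrite norm_normc ltcR => /dP; rewrite mulrC.
  by rewrite !norm_normc -rmorphM/= lecR.
have [|d /pos_complexE[k k0 ->] dP] := fA e%:C; first by rewrite ltcR.
exists k => // h hk; have := dP h; rewrite !norm_normc ltcR => /(_ hk).
by rewrite -rmorphM/= lecR [A * h]mulrC.
Qed.

End complex_modulus.

(** * The complex exponential *)

Section complex_exponential.
Variable R : realType.
Implicit Types z w h : R[i].

Definition cexp z : R[i] :=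
  (expR (complex.Re z) * cos (complex.Im z)) +i* (expR (complex.Re z) * sin (complex.Im z)).

Lemma cexpD z w : cexp (z + w) = cexp z * cexp w.
Proof.
case: z w => [a b] [c d]; rewrite /cexp/= expRD cosD sinD.
by apply/eqP; rewrite eq_complex /=; apply/andP; split; apply/eqP; ring.
Qed.

Lemma cexp0 : cexp 0 = 1.
Proof. by rewrite /cexp/= expR0 cos0 sin0 mulr1 mulr0. Qed.

Lemma normc_cexp z : normc (cexp z) = expR (complex.Re z).
Proof.
rewrite /cexp/= !exprMn -mulrDr cos2Dsin2 mulr1 sqrtr_sqr ger0_norm ?expR_ge0//.
Qed.

Lemma cexp_2pi s : cexp (s +i* (pi *+ 2)) = cexp (s +i* 0).
Proof. by rewrite /cexp/= cos2pi sin2pi cos0 sin0. Qed.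

Lemma real_expands_at (f : R -> R) (x m : R) : is_derive x 1 f m ->
  forall e, 0 < e -> exists2 dl : R, 0 < dl &
    forall h : R, `|h| < dl -> `|f (x + h) - f x - m * h| <= e * `|h|.
Proof.
move=> /is_derive_expandsP fm e /fm[d d0 dP]; exists d => // h /dP.
by rewrite [m * h]mulrC.
Qed.

(** With [h = s + i t], the real part of [exp h - 1 - h] is
    [(exp s - 1 - s) + exp s * (cos t - 1)] and its imaginary part is
    [exp s * (sin t - t) + (exp s - 1) * t]; each term is small with respect to
    [h] by the real derivatives at [0]. *)
Lemma cexp_expands0 : complex_expands_at cexp 0 1.
Proof.
move=> e0 e00.
have [e [e_gt0 e_le1 e_le]] : exists e, [/\ 0 < e, e <= 1 & e * 9 <= e0].
  exists (Num.min 1 (e0 / 9)).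
  by rewrite lt_min ltr01 divr_gt0// -ler_pdivlMr// !ge_min !lexx orbT.
have [d1 d10 exp1] := real_expands_at (is_derive_expR (0 : R)) e_gt0.
have [d2 d20 cos1] := real_expands_at (is_derive_cos (0 : R)) e_gt0.
have [d3 d30 sin1] := real_expands_at (is_derive_sin (0 : R)) e_gt0.
pose d := Num.min (Num.min d1 d2) (Num.min d3 e).
exists d; first by rewrite !lt_min d10 d20 d30 e_gt0.
move=> h; rewrite !lt_min => /andP[/andP[h1 h2] /andP[h3 h4]].
have hs := normr_Re_le h; have ht := normr_Im_le h.
rewrite add0r cexp0 mul1r; apply: le_trans (normc_le_ReIm _) _.
case: h h1 h2 h3 h4 hs ht => s t; set N := normc _ => h1 h2 h3 h4 /= hs ht.
have := exp1 s (le_lt_trans hs h1); have := cos1 t (le_lt_trans ht h2).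
have := sin1 t (le_lt_trans ht h3).
rewrite !add0r expR0 cos0 sin0 !oppr0 mul0r !mul1r !subr0 ?addr0.
set E := expR s; set c := cos t; set S := sin t => kS kc kE.
have E1 : `|E - 1| <= 2 * `|s|.
  have -> : E - 1 = (E - 1 - s) + s by ring.
  apply: le_trans (ler_normD _ _) _.
  by have := normr_ge0 s; nra.
have E3 : `|E| <= 3.
  have -> : E = (E - 1) + 1 by ring.
  by apply: le_trans (ler_normD _ _) _; rewrite normr1; lra.
have c1 : `|c| <= 1 by rewrite cos_max.
have Nge0 : 0 <= N by apply: le_trans (normr_ge0 _) hs.
have {E1}E1 : `|E - 1| <= 2 * N by lra.
have re : `|E * c - 1 - s| <= e * N + 3 * (e * N).
  have -> : E * c - 1 - s = (E - 1 - s) + E * (c - 1) by ring.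
  apply: le_trans (ler_normD _ _) _; rewrite normrM; apply: lerD.
    by apply: le_trans kE _; rewrite ler_pM2l.
  apply: ler_pM => //; apply: le_trans kc _; by rewrite ler_pM2l.
have im : `|E * S - t| <= 3 * (e * N) + (2 * N) * e.
  have -> : E * S - t = E * (S - t) + (E - 1) * t by ring.
  apply: le_trans (ler_normD _ _) _; rewrite !normrM; apply: lerD; apply: ler_pM => //.
    by apply: le_trans kS _; rewrite ler_pM2l.
  exact: le_trans ht (ltW h4).
have eN : e * N * 9 <= e0 * N by rewrite mulrAC ler_wpM2r.
by apply: le_trans (lerD re _) _; [rewrite ?subr0 ?addr0; exact: im|lra].
Qed.

Lemma is_derive_cexp z : is_derive z (1 : R[i]) cexp (cexp z).
Proof.
apply/complex_expandsP => e e0.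
have c0 : 0 < normc (cexp z) by rewrite normc_cexp expR_gt0.
have [d d0 dP] := cexp_expands0 (divr_gt0 e0 c0); exists d => // h /dP.
rewrite add0r cexp0 mul1r cexpD.
have -> : cexp z * cexp h - cexp z - cexp z * h = cexp z * (cexp h - 1 - h) by ring.
by rewrite normcM mulrAC ler_pdivlMr// mulrC.
Qed.

Lemma cexp_neq0 z : cexp z != 0.
Proof. by rewrite -normc_eq0 normc_cexp gt_eqF// expR_gt0. Qed.

End complex_exponential.

(** * Cauchy's bound on the derivative *)

Section derivative_bound.
Variable R : realType.
Implicit Types (f : R[i] -> R[i]) (z A : R[i]).

(** The Cauchy-Riemann equations for the imaginary part of [f(w) dw], which is
    [Im f ds + Re f dt] in the coordinates [w = s + i t]. *)
Lemma expands_closed_form f s t A : complex_expands_at f (s +i* t) A ->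
  closed_form_at (fun s t => complex.Im (f (s +i* t)))
                 (fun s t => complex.Re (f (s +i* t))) s t.
Proof.
case: A => a b fA; exists b, a, (- b) => e e0.
have [d d0 dP] := fA e e0; exists (d / 2); first by rewrite divr_gt0.
move=> h k hd kd.
have hk : normc (h +i* k) <= `|h| + `|k| by exact: normc_le_ReIm.
have /dP H : normc (h +i* k) < d by apply: le_lt_trans hk _; lra.
have {}H := le_trans H (ler_wpM2l (ltW e0) hk).
have := le_trans (normr_Im_le _) H; have := le_trans (normr_Re_le _) H.
rewrite (_ : s +i* t + h +i* k = (s + h) +i* (t + k))//.
case: (f _) => u v; case: (f _) => u' v' /=.
by rewrite [a * k + _]addrC mulNr => H1 H2; split.
Qed.

(** The factor [conjc A] in [G] below rotates [A = f' 0] to the positive axis,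
    so that the real part alone, which is what the closed form integrates, sees
    the full modulus of [A]. *)
Lemma cauchy_derivative_bound f A (r M : R) : 0 < r -> 
  (forall z, normc z <= r -> derivable f z 1 /\ normc (f z) <= M) ->
  complex_expands_at f 0 A -> normc A <= 2 * M / r.
Proof.
move=> r0 fP fA.
have [->|A0] := eqVneq A 0.
  rewrite ComplexField.Normc.normc0 divr_ge0 ?mulr_ge0 ?(ltW r0)//.
  have [] := fP 0; rewrite ?ComplexField.Normc.normc0 ?(ltW r0)// => _.
  exact: le_trans (normc_ge0 _).
have nA0 : 0 < normc A by rewrite lt_neqAle eq_sym normc_eq0 A0 normc_ge0.
apply/ler_addgt0Pr => e e0.
pose G w := conjc A * ((f (cexp w) - f 0) / cexp w).
have [d d0 dP] := fA e e0.
have G1 w : normc (cexp w) < d -> normc (G w - conjc A * A) <= normc A * e.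
  move=> /dP; rewrite add0r => H.
  rewrite /G -mulrBr normcM normc_conj ler_pM2l//.
  have E0 := cexp_neq0 w; have nE0 : 0 < normc (cexp w) by rewrite normc_cexp expR_gt0.
  rewrite -(ler_pM2r nE0) -normcM mulrBl divfK//.
have G2 w : normc (cexp w) = r -> normc (G w) <= normc A * (2 * M / r).
  move=> wr; rewrite /G !normcM normc_conj ComplexField.Normc.normcV wr ler_pM2l//.
  rewrite ler_pM2r ?invr_gt0//; apply: le_trans (normc_triangle _ _) _.
  rewrite normcN mulr_natl mulr2n; apply: lerD; apply: (fP _ _).2; first by rewrite wr.
  by rewrite ComplexField.Normc.normc0 ltW.
have GD w : complex.Re w <= ln r -> exists B, complex_expands_at G w B.
  move=> wr.
  have dF : derivable (fun w => (f (cexp w) - f 0) / cexp w) w 1.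
    apply: derivable_comp_quotient; first exact: cexp_neq0.
      apply: (fP _ _).1; rewrite normc_cexp -ler_ln ?posrE ?expR_gt0//.
      by rewrite expRK.
    exact: (@ex_derive _ _ _ _ _ _ _ (is_derive_cexp _)).
  have [B /is_derive_expandsP/complex_expandsP BP] := (derivable_expandsP _ _).1 dF.
  exists (conjc A * B) => e1 e10; have [d1 d10 d1P] := BP _ (divr_gt0 e10 nA0).
  exists d1 => // h /d1P; rewrite /G -!mulrA -!mulrBr normcM normc_conj.
  by rewrite mulrA mulrAC ler_pdivlMr// [X in X <= _]mulrC.
have [s2 s2r s2E] : exists2 s2, s2 <= ln r & expR s2 = r.
  by exists (ln r); rewrite ?lnK.
have [s1 s12 s1d] : exists2 s1, s1 <= s2 & expR s1 < d.
  have m0 : 0 < Num.min r (d / 2) by rewrite lt_min r0 divr_gt0.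
  exists (ln (Num.min r (d / 2))).
    by rewrite -ler_expR s2E lnK ?posrE// ge_min lexx.
  by rewrite lnK ?posrE// (le_lt_trans (y := d / 2)) ?ge_min ?lexx ?orbT//; lra.
have [T T0 T2pi] : exists2 T : R, 0 < T & forall s, cexp (s +i* T) = cexp (s +i* 0).
  by exists (pi *+ 2) => [|s]; rewrite ?cexp_2pi// mulrn_wgt0// pi_gt0.
pose P s t := complex.Im (G (s +i* t)); pose Q s t := complex.Re (G (s +i* t)).
have PQ : closed_form_on P Q s1 s2 0 T.
  move=> s t; rewrite !in_itv/= => /andP[_ ss2] _.
  by have [B] := GD (s +i* t) (le_trans ss2 s2r); exact: expands_closed_form.
have := loop_int_eq0 s12 (ltW T0) PQ; rewrite /loop_int.
(* By periodicity the two horizontal edges cancel. *)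
have -> : P^~ T = P^~ 0 by apply/funext => s; rewrite /P /G T2pi.
rewrite subrr add0r => /eqP; rewrite subr_eq0 => /eqP QQ.
(* On the left edge [exp w] is close to [0] and [G] close to its limit. *)
have Q1 : `|seg_int (Q s1) 0 T - normc A ^+ 2 * (T - 0)| <= normc A * e * (T - 0).
  apply: seg_int_near; first exact: ltW.
    by apply: closed_form_cont_y PQ _; rewrite in_itv/= lexx.
  move=> t _; rewrite -Re_mul_conj /Q; set w := s1 +i* t.
  have -> : complex.Re (G w) - complex.Re (conjc A * A) = complex.Re (G w - conjc A * A).
    by case: (G w) (conjc A * A) => [? ?] [? ?].
  by apply: le_trans (normr_Re_le _) _; apply: G1; rewrite normc_cexp.
(* On the right edge [exp w] runs over the circle of radius [r]. *)
have Q2 : `|seg_int (Q s2) 0 T - 0 * (T - 0)| <= normc A * (2 * M / r) * (T - 0).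
  apply: seg_int_near; first exact: ltW.
    by apply: closed_form_cont_y PQ _; rewrite in_itv/= s12 lexx.
  move=> t _; rewrite subr0 /Q.
  by apply: le_trans (normr_Re_le _) _; apply: G2; rewrite normc_cexp.
move: Q1 Q2; rewrite -QQ !subr0 mul0r subr0 !ler_norml => /andP[Q1 _] /andP[_ Q2].
rewrite -(ler_pM2l nA0) -(ler_pM2r T0); move: Q1; rewrite expr2; move: Q2; clear.
by move: (seg_int _ _ _) (2 * M / r) (normc A) => I J N; lra.
Qed.

End derivative_bound.

(** * Lipschitz estimate for bounded holomorphic functions *)

Section disc_lipschitz.
Variable R : realType.

(** The mean value theorem has no complex version, but it applies to the real
    function [t |-> Re (conjc c * f (a + t v))] with [c] the increment of [f];
    this function increases by the square of the modulus of [c]. *)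
Lemma mean_value_normc (f : R[i] -> R[i]) (a v : R[i]) (K : R) :
  (forall t : R, 0 <= t <= 1 -> exists2 A,
     is_derive (a + t%:C * v) (1 : R[i]) f A & normc A <= K) ->
  normc (f (a + v) - f a) <= K * normc v.
Proof.
move=> fP; set c := f (a + v) - f a.
have K0 : 0 <= K.
  by have [|A _] := fP 0; rewrite ?lexx ?ler01//; apply: le_trans (normc_ge0 _).
have [c0|c0] := eqVneq (normc c) 0; first by rewrite c0 mulr_ge0 ?normc_ge0.
have nc0 : 0 < normc c by rewrite lt_neqAle eq_sym c0 normc_ge0.
pose phi (t : R) := complex.Re (conjc c * f (a + t%:C * v)).
have phiP (t : R) : 0 <= t <= 1 -> exists2 m : R, is_derive t (1:R) phi m &
    `|m| <= normc c * (K * normc v).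
  move=> /fP[A /complex_expandsP fA AK].
  exists (complex.Re (conjc c * (A * v))); last first.
    apply: le_trans (normr_Re_le _) _; rewrite !normcM normc_conj ler_pM2l//.
    by rewrite ler_wpM2r ?normc_ge0.
  apply/is_derive_expandsP => e e0.
  have nv0 : 0 < normc v + 1 by rewrite ltr_wpDl ?normc_ge0.
  have [d d0 dP] := fA _ (divr_gt0 e0 (mulr_gt0 nc0 nv0)).
  exists (d / (normc v + 1)); first by rewrite divr_gt0.
  move=> h; rewrite ltr_pdivlMr// => hd.
  have hv : normc (h%:C * v) <= `|h| * (normc v + 1).
    by rewrite normcM normc_real ler_wpM2l// lerDl.
  have := dP (h%:C * v) (le_lt_trans hv hd) => H.
  rewrite [h *: _](_ : _ = complex.Re (h%:C * (conjc c * (A * v)))); last first.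
    by case: (conjc c * _) => p q /=; rewrite mul0r subr0.
  have -> : phi (t + h) - phi t - complex.Re (h%:C * (conjc c * (A * v))) =
     complex.Re (conjc c * (f (a + t%:C * v + h%:C * v) - f (a + t%:C * v) - A * (h%:C * v))).
    rewrite /phi (_ : a + (t + h)%:C * v = a + t%:C * v + h%:C * v); last first.
      by rewrite rmorphD/= mulrDl addrA.
    rewrite !mulrBr.
    rewrite (_ : conjc c * (A * (h%:C * v)) = h%:C * (conjc c * (A * v))); last by ring.
    case: (conjc c * _) => ? ?; case: (conjc c * _) => ? ?.
    by case: (_ * (conjc c * _)) => ? ?.
  apply: le_trans (normr_Re_le _) _; rewrite normcM normc_conj.
  rewrite mulrC -ler_pdivlMr//; apply: le_trans H _.
  apply: le_trans (ler_wpM2l _ hv) _; first by rewrite ltW// divr_gt0// mulr_gt0.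
  rewrite le_eqVlt; apply/orP; left; apply/eqP; field.
  by rewrite !gt_eqF.
have phiD (t : R) : 0 <= t <= 1 ->
    derivable phi t 1 /\ `|'D_1 phi t| <= normc c * (K * normc v).
  by move=> /phiP[m [dm <-]].
have [t tI] : exists2 t : R, t \in `[0, 1] & phi 1 - phi 0 = 'D_1 phi t * (1 - 0).
  apply: (@MVT_segment R phi ('D_1 phi) 0 1) => //.
    move=> t; rewrite in_itv/= => /andP[t0 t1].
    by apply: DeriveDef => //; apply: (phiD t _).1; rewrite !ltW.
  apply: derivable_within_continuous => t; rewrite in_itv/= => tI.
  exact: (phiD t _).1.
rewrite subr0 mulr1 => phiE.
have : phi 1 - phi 0 = normc c ^+ 2.
  rewrite /phi mul1r rmorph0 mul0r addr0 -Re_mul_conj.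
  have -> : conjc c * c = conjc c * f (a + v) - conjc c * f a by rewrite -mulrBr.
  by case: (conjc c * _) => ? ?; case: (conjc c * _) => ? ?.
rewrite phiE => phi2; have [|_] := phiD t; first by move: tI; rewrite in_itv.
by rewrite phi2 ger0_norm ?sqr_ge0// expr2 ler_pM2l.
Qed.

(** Every point of the segment from [a] to [z] has distance at least
    [(1 - |a|) / 2] to the unit circle; Cauchy's bound on a disc of half that
    radius, so that its closure is inside, gives the constant [8]. *)
Lemma disc_lipschitz (f : R[i] -> R[i]) (a z : R[i]) (M : R) :
  (forall z, normc z < 1 -> derivable f z 1 /\ normc (f z) <= M) ->
  normc a < 1 -> normc (z - a) <= (1 - normc a) / 2 ->
  normc (f z - f a) <= 8 * M / (1 - normc a) * normc (z - a).
Proof.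
move=> fP a1 za.
rewrite -[z in f z](subrK a) [_ - _ + _]addrC; apply: mean_value_normc => t /andP[t0 t1].
set x := a + t%:C * (z - a).
have xa : normc x <= normc a + (1 - normc a) / 2.
  apply: le_trans (normc_triangle _ _) _; rewrite lerD2l normcM normc_real ger0_norm//.
  by apply: le_trans za; rewrite ler_piMl ?normc_ge0.
have [|/derivable_expandsP[A fA] _] := fP x; first by lra.
exists A; first exact/is_derive_expandsP.
have -> : 8 * M / (1 - normc a) = 2 * M / ((1 - normc a) / 4).
  by field; rewrite subr_eq0 gt_eqF.
have xw w : normc w <= (1 - normc a) / 4 -> normc (x + 1 * w) < 1.
  by move=> wr; apply: le_lt_trans (normc_triangle _ _) _; rewrite mul1r; lra.
apply: (@cauchy_derivative_bound _ (fun w => f (x + 1 * w))); first by lra.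
  move=> w /xw/fP[df fM]; split; last exact: fM.
  exact: (@derivable_affine R[i] R[i]^o f x 1 w df).
move/is_derive_expandsP/complex_expandsP: fA => fA e /fA[d d0 dP].
by exists d => // h /dP; rewrite !mul1r add0r addr0.
Qed.

End disc_lipschitz.

(** * Poincare distance and Euclidean distance *)

Section poincare.
Variable R : realType.
Implicit Types (a b : R[i]) (t : R).

Definition moebius_mod a b : R := normc (a - b) / normc (1 - conjc a * b).

Lemma poincare_distE a b : poincare_dist a b =
  ln ((1 + moebius_mod a b) / (1 - moebius_mod a b)) / 2.
Proof.
rewrite /poincare_dist /moebius_mod; congr (ln (_ / _) / 2).
  by congr (1 + _); rewrite norm_normc/= normcM ComplexField.Normc.normcV.
by congr (1 - _); rewrite norm_normc/= normcM ComplexField.Normc.normcV.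
Qed.

Lemma moebius_identity a b :
  normc (1 - conjc a * b) ^+ 2 - normc (a - b) ^+ 2 =
  (1 - normc a ^+ 2) * (1 - normc b ^+ 2).
Proof.
case: a b => [p q] [u v]; rewrite -!Re_mul_conj /=; ring.
Qed.

Lemma moebius_mod_ge0 a b : 0 <= moebius_mod a b.
Proof. by rewrite divr_ge0 ?normc_ge0. Qed.

Section in_disc.
Variables (a b : R[i]).
Hypotheses (a1 : normc a < 1) (b1 : normc b < 1).

Lemma moebius_den_gt : normc (a - b) < normc (1 - conjc a * b).
Proof.
have := moebius_identity a b; move: (a1) (b1).
move: (normc_ge0 a) (normc_ge0 b) (normc_ge0 (a - b)) (normc_ge0 (1 - conjc a * b)).
move: (normc a) (normc b) (normc (a - b)) (normc (1 - _)) => A B x y.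
move=> A0 B0 x0 y0 A1 B1 xyE.
have : 0 < (1 - A ^+ 2) * (1 - B ^+ 2) by rewrite mulr_gt0// subr_gt0 expr_lt1.
by rewrite -xyE subr_gt0 ltr_pXn2r// nnegrE.
Qed.

Lemma moebius_mod_lt1 : moebius_mod a b < 1.
Proof.
by rewrite ltr_pdivrMr ?mul1r ?moebius_den_gt// (le_lt_trans (normc_ge0 _) moebius_den_gt).
Qed.

(** Writing [1 - conjc a * b] as [1 - |a|^2 + conjc a * (a - b)] bounds its
    modulus by [2 * (1 - |a|) + |a - b|]; the last term is absorbed since the
    quotient is at most [1/2]. *)
Lemma moebius_mod_dist : moebius_mod a b <= 1 / 2 ->
  normc (b - a) <= 4 * moebius_mod a b * (1 - normc a).
Proof.
have den0 : 0 < normc (1 - conjc a * b).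
  exact: le_lt_trans (normc_ge0 _) moebius_den_gt.
have tT : moebius_mod a b * normc (1 - conjc a * b) = normc (a - b).
  by rewrite /moebius_mod divfK// gt_eqF.
have Tle : normc (1 - conjc a * b) <= (1 - normc a ^+ 2) + normc a * normc (a - b).
  have -> : 1 - conjc a * b = (1 - normc a ^+ 2)%:C + conjc a * (a - b).
    by rewrite -Re_mul_conj; case: (a) (b) => [p q] [u v]; apply/eqP;
      rewrite eq_complex /=; apply/andP; split; apply/eqP; ring.
  apply: le_trans (normc_triangle _ _) _.
  rewrite normcM normc_conj normc_real ger0_norm// subr_ge0.
  by rewrite expr_le1// ?normc_ge0// ltW.
move: tT Tle (moebius_mod_ge0 a b); rewrite [normc (b - a)]normc_sub.
move: den0 (normc_ge0 (a - b)) (normc_ge0 a) (a1).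
move: (moebius_mod a b) (normc (a - b)) (normc (1 - _)) (normc a) => t x T A.
move=> T0 x0 A0 A1 tT Tle t0 t12.
have Ax : A * x <= x by rewrite ler_piMl// ltW.
have A2 : 1 - A ^+ 2 <= 2 * (1 - A) by nra.
have tT' : t * T <= t * (2 * (1 - A) + x) by rewrite ler_wpM2l//; lra.
have : t * x <= 1 / 2 * x by rewrite ler_wpM2r.
lra.
Qed.

Lemma poincare_ge : moebius_mod a b <= 2 * poincare_dist a b.
Proof.
have t0 := moebius_mod_ge0 a b; have t1 := moebius_mod_lt1.
rewrite poincare_distE mulrC divfK//; move: (moebius_mod a b) t0 t1 => t t0 t1.
have t1p : 0 < 1 + t by lra.
have t1m : 0 < 1 - t by lra.
rewrite -[X in ln X]invrK lnV ?posrE ?invr_gt0 ?divr_gt0// invf_div.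
have -> : (1 - t) / (1 + t) = 1 + - (2 * t / (1 + t)) by field; rewrite gt_eqF.
have lb : -1 < - (2 * t / (1 + t)) by rewrite ltrN2 ltr_pdivrMr//; lra.
have := le_ln1Dx lb; have : t <= 2 * t / (1 + t) by rewrite ler_pdivlMr//; nra.
lra.
Qed.

Lemma poincare_le : moebius_mod a b <= 1 / 2 -> poincare_dist a b <= 2 * moebius_mod a b.
Proof.
have t0 := moebius_mod_ge0 a b.
rewrite poincare_distE; move: (moebius_mod a b) t0 => t t0 t12.
have t1m : 0 < 1 - t by lra.
have -> : (1 + t) / (1 - t) = 1 + 2 * t / (1 - t) by field; rewrite gt_eqF.
have lb : -1 < 2 * t / (1 - t) by rewrite (lt_le_trans (ltrN10 _))// divr_ge0 ?mulr_ge0// ltW.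
have := le_ln1Dx lb; have : 2 * t / (1 - t) <= 4 * t by rewrite ler_pdivrMr//; nra.
lra.
Qed.

End in_disc.

Lemma poincare_ge0 a b : normc a < 1 -> normc b < 1 -> 0 <= poincare_dist a b.
Proof.
move=> a1 b1; have := poincare_ge a1 b1; have := moebius_mod_ge0 a b; lra.
Qed.

Lemma poincare0_le b : normc b <= 1 / 2 -> poincare_dist 0 b <= 2 * normc b.
Proof.
have bE : moebius_mod 0 b = normc b.
  by rewrite /moebius_mod rmorph0 mul0r subr0 sub0r normcN ComplexField.Normc.normc1 divr1.
by rewrite -bE; exact: poincare_le.
Qed.

End poincare.

(** * Coordinates of row vectors *)

Section row_vectors.
Variables (R : realType) (d : nat).
Implicit Types (x y : 'rV[R[i]]_d) (A U W : set 'rV[R[i]]_d).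

Lemma coord_le_norm x i : (normc (x 0 i))%:C <= `|x|.
Proof.
rewrite -norm_normc [leRHS]/Num.Def.normr/= mx_normE -[leLHS]nngE num_le.
exact: (le_bigmax _ (fun ij : 'I_1 * 'I_d => `|x ij.1 ij.2|%:nng) (0, i)).
Qed.

Lemma norm_lt_coord x (e : R) : 0 < e -> (forall i, normc (x 0 i) < e) -> `|x| < e%:C.
Proof.
move=> e0 xe; rewrite [ltLHS]/Num.Def.normr/=.
have [->|/mx_norm_neq0[[i j] ->]] := eqVneq (mx_norm x) 0; first by rewrite ltcR.
by rewrite norm_normc ltcR ord1.
Qed.

Lemma bounded_coord A : bounded_set A ->
  exists2 M : R, 0 <= M & forall x i, A x -> normc (x 0 i) <= M.
Proof.
move=> [M [Mr MA]]; exists (`|complex.Re M| + 1) => [|x i Ax]; first by rewrite addr_ge0.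
rewrite -lecR; apply: le_trans (coord_le_norm _ _) _.
apply: (MA _ _ x Ax); rewrite -(RRe_real Mr) ltcR.
by apply: le_lt_trans (ler_norm _) _; rewrite ltrDl.
Qed.

(** A compact set has positive distance to the complement of an open set that
    contains it; the distance is measured coordinate by coordinate. *)
Lemma compactly_contained_margin W U : open U -> compactly_contained W U ->
  exists2 e : R, 0 < e & forall x y, W x -> (forall i, normc (y 0 i - x 0 i) < e) -> U y.
Proof.
move=> oU [/compact_near_coveringP cW WU].
pose P (e : R) x := forall y, (forall i, normc (y 0 i - x 0 i) < e) -> U y.
have [|e /= e0 eP] := cW R (0^'+) P _.
  move=> x /WU Ux; have /nbhs_ballP[_ /= /pos_complexE[r r0 ->] rU] : nbhs x U.
    exact: open_nbhs_nbhs.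
  have r20 : 0 < r / 2 by rewrite divr_gt0.
  exists (ball x (r / 2)%:C, [set e : R | e < r / 2]) => /=.
    split; first by apply: nbhsx_ballx; rewrite ltcR.
    exact: nbhs_right_lt.
  move=> [x' e] /= [xx' er] y ye; apply: rU; rewrite -ball_normE /=.
  rewrite (_ : r%:C = (r / 2)%:C + (r / 2)%:C); last by rewrite -rmorphD/= -splitr.
  have -> : x - y = (x - x') + (x' - y) by rewrite addrA subrK.
  apply: le_lt_trans (ler_normD _ _) _; apply: ltrD.
    by move: xx'; rewrite -ball_normE.
  rewrite -normrN opprB; apply: norm_lt_coord => // i.
  by rewrite !mxE; exact: lt_trans (ye i) er.
have e20 : 0 < e / 2 by rewrite divr_gt0.
exists (e / 2) => // x y Wx; apply: (eP (e / 2)) => //; last exact: subset_closure.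
by rewrite /ball_/= sub0r normrN gtr0_norm//; lra.
Qed.

End row_vectors.

(** * Localization of short chains *)

Section localization.
Variables (R : realType) (d : nat).
Implicit Types (D U W Omega : set 'rV[R[i]]_d).

Lemma unit_discE (z : R[i]) : unit_disc z <-> normc z < 1.
Proof. by rewrite /unit_disc/= norm_normc ltcR. Qed.

Lemma holomorphic_disc_displacement D (f : R[i] -> 'rV[R[i]]_d) (M : R) a z i :
  (forall x i, D x -> normc (x 0 i) <= M) -> holomorphic_disc D f ->
  normc a < 1 -> normc (z - a) <= (1 - normc a) / 2 ->
  normc (f z 0 i - f a 0 i) <= 8 * M / (1 - normc a) * normc (z - a).
Proof.
move=> DM fD; apply: (@disc_lipschitz _ (fun z => f z 0 i)) => w w1.
have [df Dfw] := fD w ((unit_discE w).2 w1); split; last exact: DM.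
exact: derivable_rV_coord.
Qed.

Lemma affine_in_disc (a w : R[i]) (r : R) : normc a < 1 -> 0 < r -> r <= 1 / 2 ->
  normc w < 1 -> normc (a + ((1 - normc a) * r)%:C * w) < 1.
Proof.
move=> a1 r0 r12 w1; apply: le_lt_trans (normc_triangle _ _) _.
rewrite normcM normc_real ger0_norm; last by rewrite mulr_ge0// ?subr_ge0 ltW.
have s0 : 0 <= (1 - normc a) * r by rewrite mulr_ge0// ?subr_ge0 ltW.
have : (1 - normc a) * r <= (1 - normc a) * (1 / 2) by rewrite ler_pM2l// subr_gt0.
have : (1 - normc a) * r * normc w <= (1 - normc a) * r by rewrite ler_piMr// ltW.
by lra.
Qed.

(** The new disc is [f] on the disc of centre [a] and radius [r * (1 - |a|)],
    which [f] maps close to [f a]. It contains [b], with room to spare, since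
    [|b - a|] is at most [8 * l * (1 - |a|)] and [l] is small with respect to
    [r]. The last conclusion controls the drift of the chain. *)
Lemma shrink_disc D U (f : R[i] -> 'rV[R[i]]_d) (a b : R[i]) (M r : R) :
  0 <= M -> (forall x i, D x -> normc (x 0 i) <= M) -> holomorphic_disc D f ->
  normc a < 1 -> normc b < 1 -> 0 < r -> r <= 1 / 2 ->
  (forall y : 'rV[R[i]]_d, (forall i, normc (y 0 i - f a 0 i) <= 8 * M * r) -> U y) ->
  poincare_dist a b <= r / 16 ->
  exists (g : R[i] -> 'rV[R[i]]_d) (b' : R[i]),
    [/\ holomorphic_disc (U `&` D) g, unit_disc b', g 0 = f a, g b' = f b &
      poincare_dist 0 b' <= 16 / r * poincare_dist a b] /\
    forall i, normc (f b 0 i - f a 0 i) <= 64 * M * poincare_dist a b.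
Proof.
move=> M0 DM fD a1 b1 r0 r12 fU lr; set l := poincare_dist a b in lr *.
have tl : moebius_mod a b <= 2 * l := poincare_ge a1 b1.
have ba : normc (b - a) <= 8 * l * (1 - normc a).
  apply: le_trans (moebius_mod_dist a1 b1 _) _; first by lra.
  by rewrite ler_pM2r ?subr_gt0//; lra.
have a1' : 0 < 1 - normc a by rewrite subr_gt0.
pose s : R := (1 - normc a) * r.
have s0 : 0 < s by rewrite mulr_gt0.
have sC : s%:C != 0 :> R[i] by rewrite -normc_eq0 normc_real gtr0_norm// gt_eqF.
have disp z i : normc (z - a) <= (1 - normc a) / 2 ->
    normc (f z 0 i - f a 0 i) <= 8 * M / (1 - normc a) * normc (z - a).
  exact: (holomorphic_disc_displacement i DM fD a1).
exists (fun w => f (a + s%:C * w)), ((b - a) / s%:C).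
have b'l : normc ((b - a) / s%:C) <= 8 * l / r.
  rewrite normcM ComplexField.Normc.normcV normc_real gtr0_norm// ler_pdivrMr//.
  apply: le_trans ba _; rewrite /s le_eqVlt; apply/orP; left; apply/eqP.
  by field; rewrite gt_eqF.
have lr2 : 8 * l / r <= 1 / 2 by rewrite ler_pdivrMr//; lra.
split; [split|].
- move=> w /unit_discE w1; have aw1 := affine_in_disc a1 r0 r12 w1.
  have [df Dfw] := fD _ ((unit_discE _).2 aw1).
  split; first exact: derivable_affine.
  split => //; apply: fU => i.
  have sw : normc (a + s%:C * w - a) <= s.
    rewrite addrAC subrr add0r normcM normc_real gtr0_norm// ler_piMr// ltW//.
  apply: le_trans (disp _ _ _) _.
    by apply: le_trans sw _; rewrite /s ler_pM2l//; lra.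
  apply: le_trans (ler_wpM2l _ sw) _; first by rewrite divr_ge0 ?mulr_ge0// ltW.
  by rewrite /s le_eqVlt; apply/orP; left; apply/eqP; field; rewrite gt_eqF.
- by apply/unit_discE; apply: le_lt_trans b'l _; lra.
- by rewrite mulr0 addr0.
- by rewrite mulrC divfK// [a + _]addrC subrK.
- apply: le_trans (poincare0_le _) _; first by lra.
  by rewrite [16 / r * l]mulrAC; lra.
move=> i; apply: le_trans (disp _ _ _) _.
  by apply: le_trans ba _; rewrite mulrC ler_pM2l//; lra.
apply: le_trans (ler_wpM2l _ ba) _; first by rewrite divr_ge0 ?mulr_ge0// ltW.
by rewrite le_eqVlt; apply/orP; left; apply/eqP; field; rewrite gt_eqF.
Qed.

(** The localization of one disc needs its starting node to be near [W]. The
    drift of the earlier nodes is controlled by their total length, hence by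
    [L], so this follows by induction along the chain. *)
Lemma chain_localization Omega U W : bounded_set Omega -> open U ->
  compactly_contained W U ->
  exists e0 C : R, [/\ 0 < e0, 0 < C & forall z w L, W z -> L < e0 ->
    chain_length Omega z w L ->
    exists2 L', chain_length (U `&` Omega) z w L' & L' <= C * L].
Proof.
move=> /bounded_coord[M M0 OmegaM] oU WU.
have [dl dl0 dlU] := compactly_contained_margin oU WU.
(* A point of the small disc lies within [8 * M * r] of its node, and the node
   within [64 * M * L], which is less than [4 * M * r], of [z]; the constant [16]
   makes the sum smaller than [dl], and [M + 1] makes the bound strict for
   [M = 0]. *)
have [r [r0 r12 Mr]] : exists r : R, [/\ 0 < r, r <= 1 / 2 & 16 * (M + 1) * r <= dl].
  have M1 : 0 < 16 * (M + 1) by lra.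
  exists (Num.min (1 / 2) (dl / (16 * (M + 1)))); split.
  - by rewrite lt_min !divr_gt0.
  - by rewrite ge_min lexx.
  - by rewrite mulrC -ler_pdivlMr// ge_min lexx orbT.
exists (r / 16), (16 / r); split; rewrite ?divr_gt0// => z w L Wz Lr.
case=> n [p [f [a [b [n0 p0 pn chain LE]]]]].
pose l j := poincare_dist (a j) (b j).
have l0 j : (j < n)%N -> 0 <= l j.
  by move=> /chain[_ /unit_discE aj /unit_discE bj _ _]; exact: poincare_ge0.
have LEl : L = \sum_(0 <= k < n) l k by rewrite big_mkord.
have lL j : (j <= n)%N -> \sum_(k < j) l k <= L.
  move=> jn; rewrite LEl -(big_mkord xpredT l) [leRHS](big_cat_nat _ (n := j))//= lerDl.
  by rewrite big_nat_cond sumr_ge0// => k; rewrite andbT => /andP[_ /l0].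
have lr j : (j < n)%N -> l j <= r / 16.
  move=> jn; apply: le_trans (ltW Lr); apply: le_trans (lL j.+1 jn).
  rewrite big_ord_recr/= lerDr sumr_ge0// => k _; apply: l0.
  exact: ltn_trans (ltn_ord k) jn.
have step j : (j < n)%N ->
    (forall i, normc (p j 0 i - z 0 i) <= 64 * M * \sum_(k < j) l k) ->
    exists (g : R[i] -> 'rV[R[i]]_d) (b' : R[i]),
    [/\ holomorphic_disc (U `&` Omega) g, unit_disc b', g 0 = p j, g b' = p j.+1 &
      poincare_dist 0 b' <= 16 / r * l j] /\
    forall i, normc (p j.+1 0 i - p j 0 i) <= 64 * M * l j.
  move=> jn pz; have [fj /unit_discE aj /unit_discE bj pj pj1] := chain j jn.
  rewrite -pj1 -{1 2}pj; apply: (shrink_disc M0 OmegaM fj aj bj r0 r12) (lr j jn).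
  move=> y; rewrite pj => ypj.
  apply: (dlU z) => // i.
  have -> : y 0 i - z 0 i = (y 0 i - p j 0 i) + (p j 0 i - z 0 i) by rewrite addrA subrK.
  apply: le_lt_trans (normc_triangle _ _) _.
  have : M * \sum_(k < j) l k <= M * (r / 16).
    by rewrite ler_wpM2l// (le_trans (lL j (ltnW jn)))// ltW.
  have : 0 <= M * r by rewrite mulr_ge0 // ltW.
  by have := ypj i; have := pz i; lra.
have pz j : (j <= n)%N -> forall i, normc (p j 0 i - z 0 i) <= 64 * M * \sum_(k < j) l k.
  elim: j => [|j IH] jn i.
    by rewrite p0 subrr ComplexField.Normc.normc0 big_ord0 mulr0.
  have [g [b' [_ pp]]] := step j jn (IH (ltnW jn)).
  have -> : p j.+1 0 i - z 0 i = (p j.+1 0 i - p j 0 i) + (p j 0 i - z 0 i).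
    by rewrite addrA subrK.
  apply: le_trans (normc_triangle _ _) _; rewrite big_ord_recr/= mulrDr addrC.
  by apply: lerD; [exact: IH (ltnW jn) i|exact: pp].
have /choice[gb gbP] : forall j, exists gb : (R[i] -> 'rV[R[i]]_d) * R[i], (j < n)%N ->
    [/\ holomorphic_disc (U `&` Omega) gb.1, unit_disc gb.2, gb.1 0 = p j,
      gb.1 gb.2 = p j.+1 &
      poincare_dist 0 gb.2 <= 16 / r * l j].
  move=> j; have [jn|jn] := ltnP j n; last by exists (fun=> 0, 0).
  by have [g [b' [? _]]] := step j jn (pz j (ltnW jn)); exists (g, b').
exists (\sum_(j < n) poincare_dist 0 (gb j).2).
  exists n, p, (fun j => (gb j).1), (fun=> 0), (fun j => (gb j).2); split => // j jn.
  have [gD b'1 g0 gb' _] := gbP j jn; split => //.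
  by apply/unit_discE; rewrite ComplexField.Normc.normc0.
rewrite LEl big_mkord mulr_sumr; apply: ler_sum => j _.
by have [] := gbP j (ltn_ord j).
Qed.

End localization.

(** * Comparison of the Kobayashi distances *)

Section kobayashi_comparison.
Variables (R : realType) (d : nat).
Implicit Types (D : set 'rV[R[i]]_d).

Lemma kobayashi_le D z w L : chain_length D z w L -> (kobayashi D z w <= L%:E)%E.
Proof. by move=> cL; apply: ereal_inf_lbound; exists L. Qed.

Lemma kobayashi_lt D z w (x : R) : (kobayashi D z w < x%:E)%E ->
  exists2 L, chain_length D z w L & L < x.
Proof. by move=> /ereal_inf_lt[_ [L cL <-]]; rewrite lte_fin; exists L. Qed.

Lemma chain_length_ge0 D z w L : chain_length D z w L -> 0 <= L.
Proof.
case=> n [p [f [a [b [_ _ _ chain ->]]]]]; apply: sumr_ge0 => j _.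
by have [_ /unit_discE aj /unit_discE bj _ _] := chain j (ltn_ord j); exact: poincare_ge0.
Qed.

End kobayashi_comparison.

Theorem theorem1p7 (R : realType) (d : nat) (hd : (1 <= d)%N)
    (Omega U W : set 'rV[R[i]]_d)
    (hOmega : domain Omega) (hOmega_bounded : bounded_set Omega)
    (hU : open U) (hW : open W) (hWU : compactly_contained W U)
    (hWOmega : W `&` Omega !=set0) (hUOmega : connected (U `&` Omega))
    (hk : exists C0 : R, 0 < C0 /\
       forall z w : 'rV[R[i]]_d, (W `&` Omega) z -> (W `&` Omega) w ->
         (kobayashi (U `&` Omega) z w <= kobayashi Omega z w + C0%:E)%E) :
  exists C : R, 1 <= C /\
    forall z w : 'rV[R[i]]_d, (W `&` Omega) z -> (W `&` Omega) w ->
      (kobayashi (U `&` Omega) z w <= C%:E * kobayashi Omega z w)%E.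
Proof.
have [C0 [C00 C0P]] := hk.
have [e0 [C [e00 C_gt0 CP]]] := chain_localization hOmega_bounded hU hWU.
exists (C + (1 + C0 / e0)); split.
  by rewrite addrCA lerDl addr_ge0// ltW// divr_gt0.
have CC0 : 0 < C0 / e0 by rewrite divr_gt0.
move=> z w zW wW; set K := kobayashi Omega z w; set C' := C + _.
have C'0 : 0 < C' by rewrite /C'; lra.
have [Ksmall|Kbig] := ltP K e0%:E.
  rewrite -lee_pdivrMl//; apply/ereal_infP => _ [L cL <-].
  (* A long chain is compared with a short one, which exists because the
     infimum is less than [e0]. *)
  have [L1 cL1 [L1e0 L1L]] : exists2 L1, chain_length Omega z w L1 & L1 < e0 /\ L1 <= L.
    have [Le|eL] := ltP L e0; first by exists L.
    have [L1 cL1 L1e] := kobayashi_lt Ksmall.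
    by exists L1 => //; split => //; rewrite (le_trans (ltW L1e)).
  have [L2 cL2 L2L] := CP z w L1 zW.1 L1e0 cL1.
  apply: (@le_trans _ _ (C'^-1%:E * L2%:E)%E).
    apply: lee_wpmul2l; first by rewrite lee_fin invr_ge0 ltW.
    exact: kobayashi_le cL2.
  rewrite -EFinM lee_fin ler_pdivrMl//; have L0 := chain_length_ge0 cL.
  have : C * L1 <= C * L by rewrite ler_pM2l.
  have : 0 <= (1 + C0 / e0) * L by rewrite mulr_ge0// addr_ge0// ltW.
  by rewrite /C' mulrDl; lra.
move: Kbig (C0P z w zW wW); rewrite -/K; case: K => [k| |]; last by rewrite leeNy_eq.
  rewrite lee_fin => ek /le_trans; apply; rewrite -EFinD -EFinM lee_fin.
  have : C0 <= C0 / e0 * k by rewrite mulrAC ler_pdivlMr// ler_pM2l.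
  have : 0 <= C * k by rewrite mulr_ge0 ?ltW// (lt_le_trans e00).
  by rewrite /C' !mulrDl mul1r; lra.
by move=> _ _; rewrite gt0_muley ?lte_fin// leey.
Qed.
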